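(* Let $n\ge1$ be an integer, $\eta>1$, $L>0$, $M>0$, $\mu=M/L$, and let $F_n(x)=\int_0^x u^n(1-u)^n\,du\big/\mathrm B(n+1,n+1)$ and $q_{n,\eta}=\max_{1\le y\le\eta}F_n[(y-1)/(\eta-1)]/y$. With $x=(r/L-1)/(\eta-1)$ and $s(x)=x(1-x)$, let $$m(r)=\begin{cases}0,&0\le r\le L,\\ M F_n(x),& L<r<\eta L,\\ M,& r\ge\eta L,\end{cases}\qquad \rho=\frac{m'}{4\pi r^2},$$ and for real $\epsilon$ consider the metric $$ds^2=-e^{2\Phi_\epsilon(r)}d\tau^2+\frac{dr^2}{1-2m(r)/r}+r^2d\Omega^2$$ with $$p_r^{(\epsilon)}=\epsilon\rho s,\qquad \Phi_\epsilon'=\frac{m+4\pi r^3p_r^{(\epsilon)}}{r(r-2m)},\qquad \Phi_\epsilon(\infty)=0,$$ $$p_\perp^{(\epsilon)}=p_r^{(\epsilon)}+\frac r2\left[(p_r^{(\epsilon)})'+(\rho+p_r^{(\epsilon)})\Phi_\epsilon'\right].$$ Then for every $n\ge1$, $\eta>1$, and strict interior point $0<\mu<0.4/q_{n,\eta}$, there is an $\epsilon_\star>0$ such that every $|\epsilon|<\epsilon_\star$ defines a horizon-free, junction-free hollow shell satisfying NEC, WEC, SEC, and DEC everywhere. Every nonzero $\epsilon$ gives $p_r^{(\epsilon)}\ne0$ in the open matter wall $L<r<\eta L$. The cavity $r\le L$ and exterior $r\ge\eta L$ remain respectively flat and exactly Schwarzschild, with the same ADM mass $M$.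
   Context: Geometric units $G=c=1$; $\mathrm B$ is the Euler beta function. Outside the wall $L<r<\eta L$ one has $\rho=0$ and hence $p_r^{(\epsilon)}=0$. The quantities $\rho,p_r^{(\epsilon)},p_\perp^{(\epsilon)}$ are the energy density, radial pressure, and tangential pressure (both angular directions) of the source $T_{\mu\nu}=G_{\mu\nu}/(8\pi)$ in the static orthonormal frame; the formula for $p_\perp^{(\epsilon)}$ is the radial conservation equation $\nabla_\mu T^{\mu r}=0$. Energy conditions: NEC: $\rho+p_r\ge0$ and $\rho+p_\perp\ge0$. WEC: $\rho\ge0$ and NEC. SEC: NEC and $\rho+p_r+2p_\perp\ge0$. DEC: $\rho\ge|p_r|$ and $\rho\ge|p_\perp|$. ''Horizon-free'' means $1-2m(r)/r>0$ for all $r>0$. ''Junction-free'' means that at $r=L$ and $r=\eta L$ the induced metric and extrinsic curvature of the worldtube $r=\text{const}$ agree from both sides ($[h_{ab}]=[K_{ab}]=0$), so that the Israel surface tensor vanishes; with $f=1-2m/r$ and normal $n^\mu=\sqrt f\,\delta^\mu_r$, the nonzero components are $K_{\tau\tau}=-e^{2\Phi_\epsilon}\sqrt f\,\Phi_\epsilon'$, $K_{\theta\theta}=r\sqrt f$, $K_{\phi\phi}=\sin^2\theta\,K_{\theta\theta}$. ''Flat cavity'' means $m=0$ and $\Phi_\epsilon$ is constant for $r\le L$. ''Exactly Schwarzschild'' means $m=M$ and $e^{2\Phi_\epsilon}=1-2M/r$ for $r\ge\eta L$. *)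

(* Defs.v *)
From Stdlib Require Import Reals Lra Arith.
From Coquelicot Require Import Coquelicot.
Open Scope R_scope.

(* Geometric units G = c = 1. *)

(* The Euler beta function at positive integers. *)
Definition euler_beta (a b : nat) : R :=
  RInt (fun t => t ^ (a - 1) * (1 - t) ^ (b - 1)) 0 1.

Definition F (n : nat) (x : R) : R :=
  RInt (fun u => u ^ n * (1 - u) ^ n) 0 x / euler_beta (n + 1) (n + 1).

Definition is_max_on (f : R -> R) (a b q : R) : Prop :=
  (exists y, a <= y <= b /\ f y = q) /\
  (forall y, a <= y <= b -> f y <= q).

Definition is_q (n : nat) (eta q : R) : Prop :=
  is_max_on (fun y => F n ((y - 1) / (eta - 1)) / y) 1 eta q.

Section Profile.
Variables (n : nat) (eta L M eps : R).

Definition wall_coord (r : R) : R := (r / L - 1) / (eta - 1).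

Definition s (x : R) : R := x * (1 - x).

(* Only r >= 0 is meaningful; the value 0 for r < 0 is a convention. *)
Definition mass (r : R) : R :=
  if Rle_dec r L then 0
  else if Rlt_dec r (eta * L) then M * F n (wall_coord r)
  else M.

(* For n >= 1 the functions mass and p_rad are differentiable on the whole line,
   so Derive is the genuine derivative, also at r = L and r = eta * L.
   At r = 0 the conventional quotient 0 / 0 = 0 gives the vacuum values. *)
Definition rho (r : R) : R := Derive mass r / (4 * PI * r ^ 2).

Definition p_rad (r : R) : R := eps * rho r * s (wall_coord r).

Definition dPhi (r : R) : R :=
  (mass r + 4 * PI * r ^ 3 * p_rad r) / (r * (r - 2 * mass r)).

Definition p_tan (r : R) : R :=
  p_rad r + r / 2 * (Derive p_rad r + (rho r + p_rad r) * dPhi r).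

(* The right-continuity at 0 only fixes the value at the centre, where the
   formula for the derivative degenerates. *)
Definition is_potential (Phi : R -> R) : Prop :=
  (forall r, 0 < r -> is_derive Phi r (dPhi r)) /\
  filterlim Phi (at_right 0) (locally (Phi 0)) /\
  is_lim Phi p_infty 0.

End Profile.

(* Points of R^k are coordinate functions nat -> R, read at indices < k. *)
Definition upd (x : nat -> R) (i : nat) (t : R) : nat -> R :=
  fun j => if Nat.eqb j i then t else x j.

Definition partial (i : nat) (f : (nat -> R) -> R) (x : nat -> R) : R :=
  Derive (fun t => f (upd x i t)) (x i).

Definition tensor2 : Type := (nat -> R) -> nat -> nat -> R.

(* Spacetime coordinates: 0 = tau, 1 = r, 2 = theta, 3 = phi. *)
Definition metric (Phi m : R -> R) : tensor2 := fun x a b =>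
  let r := x 1%nat in
  match a, b with
  | 0%nat, 0%nat => - exp (2 * Phi r)
  | 1%nat, 1%nat => / (1 - 2 * m r / r)
  | 2%nat, 2%nat => r ^ 2
  | 3%nat, 3%nat => r ^ 2 * sin (x 2%nat) ^ 2
  | _, _ => 0
  end.

Section Curvature.
Variable g : tensor2.

(* The inverse metric, for a diagonal metric g. *)
Definition inv_diag : tensor2 := fun x a b =>
  if Nat.eqb a b then / g x a a else 0.

(* Gamma^a_{bc} *)
Definition christoffel (a b c : nat) (x : nat -> R) : R :=
  / 2 * sum_f_R0 (fun d => inv_diag x a d *
    (partial b (fun y => g y d c) x + partial c (fun y => g y d b) x
     - partial d (fun y => g y b c) x)) 3.

(* R^a_{bcd} = d_c Gamma^a_{db} - d_d Gamma^a_{cb}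
               + Gamma^a_{ce} Gamma^e_{db} - Gamma^a_{de} Gamma^e_{cb} *)
Definition riemann (a b c d : nat) (x : nat -> R) : R :=
  partial c (christoffel a d b) x - partial d (christoffel a c b) x
  + sum_f_R0 (fun e => christoffel a c e x * christoffel e d b x
                       - christoffel a d e x * christoffel e c b x) 3.

Definition ricci : tensor2 := fun x b d =>
  sum_f_R0 (fun a => riemann a b a d x) 3.

Definition scalar_curvature (x : nat -> R) : R :=
  sum_f_R0 (fun a => sum_f_R0 (fun b => inv_diag x a b * ricci x a b) 3) 3.

Definition einstein : tensor2 := fun x a b =>
  ricci x a b - / 2 * scalar_curvature x * g x a b.

(* Components of T = G / (8 pi) in the orthonormal frame |g_aa|^(-1/2) d_a. *)
Definition source_frame : tensor2 := fun x a b =>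
  einstein x a b / (8 * PI) / (sqrt (Rabs (g x a a)) * sqrt (Rabs (g x b b))).

End Curvature.

Definition fluid_frame (rho_ p_r p_t : R) (a b : nat) : R :=
  match a, b with
  | 0%nat, 0%nat => rho_
  | 1%nat, 1%nat => p_r
  | 2%nat, 2%nat => p_t
  | 3%nat, 3%nat => p_t
  | _, _ => 0
  end.

(* The chart is regular where r > 0 and 0 < theta < pi. *)
Definition sourced_by (Phi m rho_ p_r p_t : R -> R) : Prop :=
  forall x : nat -> R, 0 < x 1%nat -> 0 < x 2%nat < PI ->
  forall a b : nat, (a <= 3)%nat -> (b <= 3)%nat ->
  source_frame (metric Phi m) x a b =
  fluid_frame (rho_ (x 1%nat)) (p_r (x 1%nat)) (p_t (x 1%nat)) a b.

Definition NEC (rho_ p_r p_t : R) : Prop := 0 <= rho_ + p_r /\ 0 <= rho_ + p_t.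
Definition WEC (rho_ p_r p_t : R) : Prop := 0 <= rho_ /\ NEC rho_ p_r p_t.
Definition SEC (rho_ p_r p_t : R) : Prop :=
  NEC rho_ p_r p_t /\ 0 <= rho_ + p_r + 2 * p_t.
Definition DEC (rho_ p_r p_t : R) : Prop := Rabs p_r <= rho_ /\ Rabs p_t <= rho_.

Definition horizon_free (m : R -> R) : Prop :=
  forall r, 0 < r -> 0 < 1 - 2 * m r / r.

(* Extrinsic curvature of the worldtube r = const, unit normal sqrt f d_r. *)
Definition extrinsic (Phi m : R -> R) : tensor2 := fun x a b =>
  let r := x 1%nat in
  let f := 1 - 2 * m r / r in
  match a, b with
  | 0%nat, 0%nat => - exp (2 * Phi r) * sqrt f * Derive Phi r
  | 2%nat, 2%nat => r * sqrt f
  | 3%nat, 3%nat => sin (x 2%nat) ^ 2 * (r * sqrt f)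
  | _, _ => 0
  end.

Definition no_jump (f : R -> R) (r0 : R) : Prop :=
  exists l : R, filterlim f (at_left r0) (locally l) /\
                filterlim f (at_right r0) (locally l).

(* The induced metric consists of the components of the metric along the
   worldtube coordinates, i.e. those with both indices different from 1. *)
Definition junction_free_at (Phi m : R -> R) (r0 : R) : Prop :=
  forall (x : nat -> R) (a b : nat), a <> 1%nat -> b <> 1%nat ->
  no_jump (fun r => metric Phi m (upd x 1 r) a b) r0 /\
  no_jump (fun r => extrinsic Phi m (upd x 1 r) a b) r0.

Definition flat_cavity (Phi m : R -> R) (L : R) : Prop :=
  (forall r, 0 <= r <= L -> m r = 0) /\
  (exists c : R, forall r, 0 <= r <= L -> Phi r = c).

Definition exactly_schwarzschild (Phi m : R -> R) (M r0 : R) : Prop :=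
  forall r, r0 <= r -> m r = M /\ exp (2 * Phi r) = 1 - 2 * M / r.

Definition norm3 (x : nat -> R) : R :=
  sqrt (x 0%nat ^ 2 + x 1%nat ^ 2 + x 2%nat ^ 2).

(* The spatial metric dr^2 / (1 - 2 m / r) + r^2 dOmega^2 in the Cartesian
   coordinates x = r (sin theta cos phi, sin theta sin phi, cos theta). *)
Definition spatial_metric (m : R -> R) : tensor2 := fun x i j =>
  let r := norm3 x in
  (if Nat.eqb i j then 1 else 0)
  + (/ (1 - 2 * m r / r) - 1) * (x i * x j / r ^ 2).

Definition adm_density (gamma : tensor2) (x : nat -> R) : R :=
  sum_f_R0 (fun i => sum_f_R0 (fun j =>
    (partial j (fun y => gamma y i j) x - partial i (fun y => gamma y j j) x)
    * (x i / norm3 x)) 2) 2.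

Definition sphere_point (r theta phi : R) (i : nat) : R :=
  match i with
  | 0%nat => r * sin theta * cos phi
  | 1%nat => r * sin theta * sin phi
  | _ => r * cos theta
  end.

Definition adm_flux (gamma : tensor2) (r : R) : R :=
  RInt (fun theta => RInt (fun phi =>
    adm_density gamma (sphere_point r theta phi) * (r ^ 2 * sin theta))
    0 (2 * PI)) 0 PI.

Definition has_adm_mass (m : R -> R) (M : R) : Prop :=
  is_lim (fun r => adm_flux (spatial_metric m) r / (16 * PI)) p_infty M.

(* Main.v *)
Require Import Defs.
From Stdlib Require Import Reals Lra Lia.
From Coquelicot Require Import Coquelicot.
Open Scope R_scope.

(* With w = m/r and x the wall coordinate, the definition of p_r gives in the wall
     p_r = rho eps s(x),
     p_t = rho [eps (n+1)/2 (1-2x) (r/L)/(eta-1)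
                + (1 + eps s)/2 (w + 4 pi r^2 rho eps s) / (1 - 2w)].
   At eps = 0 the ratio p_t/rho is w / (2(1-2w)), which lies in [0, 1) because
   w <= mu q < 2/5.  By compactness of the wall the corrections are O(eps)
   uniformly, so |p_r| and |p_t| stay below rho, and p_t stays above -rho/4.
   The densities vanish to order n at both edges and s adds one more order, so
   p_r is C^1 and Phi is C^2: there is no surface layer.  The equation for Phi'
   and the conservation equation are the rr and angular Einstein equations. *)

(** * Curvature of a static spherically symmetric metric *)

Section Static.
Variables (Phi m P dm dP : R -> R).
Hypothesis Phi_derive : forall r, 0 < r -> is_derive Phi r (P r).
Hypothesis m_derive : forall r, 0 < r -> is_derive m r (dm r).
Hypothesis P_derive : forall r, 0 < r -> is_derive P r (dP r).
Hypothesis no_horizon : forall r, 0 < r -> 0 < 1 - 2 * m r / r.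

Let f r := 1 - 2 * m r / r.
Let df r := 2 * m r / r ^ 2 - 2 * dm r / r.

Lemma f_derive r : 0 < r -> is_derive f r (df r).
Proof.
intros Hr; unfold f, df.
assert (H := m_derive r Hr).
auto_derive.
- split; [exists (dm r); exact H | split; [lra | easy]].
- replace (Derive (fun x => m x) r) with (dm r) by (symmetry; apply is_derive_unique, H).
  field; lra.
Qed.

Definition dmetric (i b c : nat) (r th : R) : R :=
  match i, b, c with
  | 1%nat, 0%nat, 0%nat => - (exp (2 * Phi r) * (2 * P r))
  | 1%nat, 1%nat, 1%nat => - (df r / f r ^ 2)
  | 1%nat, 2%nat, 2%nat => 2 * r
  | 1%nat, 3%nat, 3%nat => 2 * r * sin th ^ 2
  | 2%nat, 3%nat, 3%nat => r ^ 2 * (2 * sin th * cos th)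
  | _, _, _ => 0
  end.

Lemma partial_metric x i b c :
  0 < x 1%nat -> (i <= 3)%nat -> (b <= 3)%nat -> (c <= 3)%nat ->
  partial i (fun y => metric Phi m y b c) x = dmetric i b c (x 1%nat) (x 2%nat).
Proof.
intros Hr Hi Hb Hc; unfold partial; apply is_derive_unique.
assert (HP := Phi_derive _ Hr). assert (Hf := f_derive _ Hr).
assert (f0 : f (x 1%nat) <> 0) by (apply Rgt_not_eq, no_horizon, Hr).
destruct i as [|[|[|[|i]]]]; try lia;
destruct b as [|[|[|[|b]]]]; try lia;
destruct c as [|[|[|[|c]]]]; try lia;
unfold metric, upd; simpl Nat.eqb; cbv iota; unfold dmetric;
try apply (@is_derive_const R_AbsRing R_NormedModule).
- auto_derive; [exists (P (x 1%nat)); exact HP |].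
  replace (Derive (fun x0 => Phi x0) (x 1%nat)) with (P (x 1%nat))
    by (symmetry; apply is_derive_unique, HP); ring.
- replace (- (df (x 1%nat) / f (x 1%nat) ^ 2)) with (- df (x 1%nat) / f (x 1%nat) ^ 2)
    by (unfold Rdiv; ring).
  apply (is_derive_inv f); assumption.
- auto_derive; [easy | ring].
- auto_derive; [easy | ring].
- auto_derive; [easy | ring].
Qed.

Definition Gam (a b c : nat) (r th : R) : R :=
  match a, b, c with
  | 0%nat, 0%nat, 1%nat | 0%nat, 1%nat, 0%nat => P r
  | 1%nat, 0%nat, 0%nat => f r * exp (2 * Phi r) * P r
  | 1%nat, 1%nat, 1%nat => - (df r / (2 * f r))
  | 1%nat, 2%nat, 2%nat => - (r * f r)
  | 1%nat, 3%nat, 3%nat => - (r * f r * sin th ^ 2)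
  | 2%nat, 1%nat, 2%nat | 2%nat, 2%nat, 1%nat => / r
  | 3%nat, 1%nat, 3%nat | 3%nat, 3%nat, 1%nat => / r
  | 2%nat, 3%nat, 3%nat => - (sin th * cos th)
  | 3%nat, 2%nat, 3%nat | 3%nat, 3%nat, 2%nat => cos th / sin th
  | _, _, _ => 0
  end.

Lemma christoffel_metric x a b c :
  0 < x 1%nat -> 0 < x 2%nat < PI ->
  (a <= 3)%nat -> (b <= 3)%nat -> (c <= 3)%nat ->
  christoffel (metric Phi m) a b c x = Gam a b c (x 1%nat) (x 2%nat).
Proof.
intros Hr Hth Ha Hb Hc; unfold christoffel, sum_f_R0.
rewrite !partial_metric by (assumption || lia).
assert (f0 : f (x 1%nat) <> 0) by (apply Rgt_not_eq, no_horizon, Hr).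
assert (s0 : sin (x 2%nat) <> 0) by (apply Rgt_not_eq, sin_gt_0; lra).
assert (E0 := exp_pos (2 * Phi (x 1%nat))).
(* Folding [1 - 2 * m r / r] back into [f] lets [clearbody] turn it into an atom, so that [field]
   only needs [f <> 0]. *)
change (metric Phi m) with (fun x a b => match a, b with
  | 0%nat, 0%nat => - exp (2 * Phi (x 1%nat))
  | 1%nat, 1%nat => / f (x 1%nat)
  | 2%nat, 2%nat => (x 1%nat) ^ 2
  | 3%nat, 3%nat => (x 1%nat) ^ 2 * sin (x 2%nat) ^ 2
  | _, _ => 0 end).
clearbody f df.
destruct a as [|[|[|[|a]]]]; try lia;
destruct b as [|[|[|[|b]]]]; try lia;
destruct c as [|[|[|[|c]]]]; try lia;
unfold inv_diag, dmetric, Gam; simpl Nat.eqb; cbv iota beta;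
try ring; field; repeat split; lra.
Qed.

(* [m] is only assumed differentiable once, so [df] need not be differentiable:
   the [r]-derivative of [Gamma^r_{rr}] stays unevaluated, as it cancels in the
   Ricci tensor. *)
Definition dGam (i a b c : nat) (r th : R) : R :=
  match i, a, b, c with
  | 1%nat, 0%nat, 0%nat, 1%nat | 1%nat, 0%nat, 1%nat, 0%nat => dP r
  | 1%nat, 1%nat, 0%nat, 0%nat =>
      exp (2 * Phi r) * (df r * P r + 2 * f r * P r ^ 2 + f r * dP r)
  | 1%nat, 1%nat, 1%nat, 1%nat => Derive (fun t => - (df t / (2 * f t))) r
  | 1%nat, 1%nat, 2%nat, 2%nat => - (f r + r * df r)
  | 1%nat, 1%nat, 3%nat, 3%nat => - ((f r + r * df r) * sin th ^ 2)
  | 2%nat, 1%nat, 3%nat, 3%nat => - (r * f r * (2 * sin th * cos th))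
  | 1%nat, 2%nat, 1%nat, 2%nat | 1%nat, 2%nat, 2%nat, 1%nat => - / r ^ 2
  | 1%nat, 3%nat, 1%nat, 3%nat | 1%nat, 3%nat, 3%nat, 1%nat => - / r ^ 2
  | 2%nat, 2%nat, 3%nat, 3%nat => sin th ^ 2 - cos th ^ 2
  | 2%nat, 3%nat, 2%nat, 3%nat | 2%nat, 3%nat, 3%nat, 2%nat =>
      - (1 + (cos th / sin th) ^ 2)
  | _, _, _, _ => 0
  end.

(** The closed form [Gam] is known only on the chart [0 < r], [0 < theta < pi]. The chart is open,
    so each coordinate line through [x] stays in it near [x] and [Gam] may be differentiated
    instead. *)
Lemma partial_christoffel x i a b c :
  0 < x 1%nat -> 0 < x 2%nat < PI ->
  (i <= 3)%nat -> (a <= 3)%nat -> (b <= 3)%nat -> (c <= 3)%nat ->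
  partial i (christoffel (metric Phi m) a b c) x = dGam i a b c (x 1%nat) (x 2%nat).
Proof.
intros Hr Hth Hi Ha Hb Hc; unfold partial.
rewrite (Derive_ext_loc _
  (fun t => Gam a b c (upd x i t 1%nat) (upd x i t 2%nat))).
2:{ assert (H1 : locally (x i) (fun t => 0 < upd x i t 1%nat)).
    { unfold upd; destruct (Nat.eqb_spec 1 i) as [<-|].
      - apply (open_gt 0), Hr.
      - now apply filter_forall. }
    assert (H2 : locally (x i) (fun t => 0 < upd x i t 2%nat)).
    { unfold upd; destruct (Nat.eqb_spec 2 i) as [<-|].
      - apply (open_gt 0), Hth.
      - now apply filter_forall. }
    assert (H3 : locally (x i) (fun t => upd x i t 2%nat < PI)).
    { unfold upd; destruct (Nat.eqb_spec 2 i) as [<-|].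
      - apply (open_lt PI), Hth.
      - now apply filter_forall. }
    generalize (filter_and _ _ H1 (filter_and _ _ H2 H3)); apply filter_imp.
    intros t Ht; apply christoffel_metric; tauto. }
assert (HP := Phi_derive _ Hr). assert (Hf := f_derive _ Hr).
assert (HdP := P_derive _ Hr).
assert (f0 : f (x 1%nat) <> 0) by (apply Rgt_not_eq, no_horizon, Hr).
assert (s0 : sin (x 2%nat) <> 0) by (apply Rgt_not_eq, sin_gt_0; lra).
assert (E1 := is_derive_unique _ _ _ HP).
assert (E2 := is_derive_unique _ _ _ Hf).
assert (E3 := is_derive_unique _ _ _ HdP).
assert (X1 : ex_derive Phi (x 1%nat)) by (eexists; exact HP).
assert (X2 : ex_derive f (x 1%nat)) by (eexists; exact Hf).
assert (X3 : ex_derive P (x 1%nat)) by (eexists; exact HdP).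
clearbody f df.
destruct i as [|[|[|[|i]]]]; try lia;
destruct a as [|[|[|[|a]]]]; try lia;
destruct b as [|[|[|[|b]]]]; try lia;
destruct c as [|[|[|[|c]]]]; try lia;
unfold upd, dGam, Gam; simpl Nat.eqb; cbv iota beta; try reflexivity;
apply is_derive_unique;
try apply (@is_derive_const R_AbsRing R_NormedModule);
try exact HdP;
(auto_derive; [repeat split; auto; lra |];
 try change (Derive (fun x0 => Phi x0)) with (Derive Phi);
 try change (Derive (fun x0 => f x0)) with (Derive f);
 try change (Derive (fun x0 => P x0)) with (Derive P);
 rewrite ?E1, ?E2, ?E3; field; try lra; auto).
Qed.

Lemma ricci_metric x b d :
  0 < x 1%nat -> 0 < x 2%nat < PI -> (b <= 3)%nat -> (d <= 3)%nat ->
  ricci (metric Phi m) x b d =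
  let r := x 1%nat in
  let th := x 2%nat in
  match b, d with
  | 0%nat, 0%nat => exp (2 * Phi r) *
      (f r * (dP r + P r ^ 2 + 2 * P r / r) + df r * P r / 2)
  | 1%nat, 1%nat => - (dP r + P r ^ 2) - df r / (2 * f r) * (P r + 2 / r)
  | 2%nat, 2%nat => 1 - f r - r * (f r * P r + df r / 2)
  | 3%nat, 3%nat => sin th ^ 2 * (1 - f r - r * (f r * P r + df r / 2))
  | _, _ => 0
  end.
Proof.
intros Hr Hth Hb Hd; unfold ricci, riemann, sum_f_R0.
rewrite !partial_christoffel by (assumption || lia).
rewrite !christoffel_metric by (assumption || lia).
assert (f0 : f (x 1%nat) <> 0) by (apply Rgt_not_eq, no_horizon, Hr).
assert (s0 : sin (x 2%nat) <> 0) by (apply Rgt_not_eq, sin_gt_0; lra).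
(* Some entries agree only modulo this identity; the rest of the computation is rational. *)
assert (C2 : cos (x 2%nat) ^ 2 = 1 - sin (x 2%nat) ^ 2)
  by (generalize (sin2_cos2 (x 2%nat)); unfold Rsqr; simpl; lra).
clearbody f df.
destruct b as [|[|[|[|b]]]]; try lia;
destruct d as [|[|[|[|d]]]]; try lia;
unfold dGam, Gam; cbv zeta; try ring; field_simplify_eq; try (repeat split; lra);
rewrite ?C2; ring.
Qed.

Lemma scalar_curvature_metric x :
  0 < x 1%nat -> 0 < x 2%nat < PI ->
  scalar_curvature (metric Phi m) x =
  let r := x 1%nat in
  - 2 * f r * (dP r + P r ^ 2) - (df r + 4 * f r / r) * P r
  - 2 * df r / r + 2 * (1 - f r) / r ^ 2.
Proof.
intros Hr Hth; unfold scalar_curvature, sum_f_R0, inv_diag; simpl Nat.eqb; cbv iota.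
rewrite !ricci_metric by (assumption || lia).
assert (f0 : f (x 1%nat) <> 0) by (apply Rgt_not_eq, no_horizon, Hr).
assert (s0 : sin (x 2%nat) <> 0) by (apply Rgt_not_eq, sin_gt_0; lra).
assert (E0 := exp_pos (2 * Phi (x 1%nat))).
unfold metric; cbv zeta; fold (f (x 1%nat)).
clearbody f df.
field; repeat split; lra.
Qed.

Lemma source_frame_metric x a b :
  0 < x 1%nat -> 0 < x 2%nat < PI -> (a <= 3)%nat -> (b <= 3)%nat ->
  source_frame (metric Phi m) x a b =
  let r := x 1%nat in
  fluid_frame ((1 - f r - r * df r) / (8 * PI * r ^ 2))
    ((2 * f r * P r / r - (1 - f r) / r ^ 2) / (8 * PI))
    ((f r * (dP r + P r ^ 2 + P r / r) + df r / 2 * (P r + / r)) / (8 * PI)) a b.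
Proof.
intros Hr Hth Ha Hb; unfold source_frame, einstein.
rewrite ricci_metric, scalar_curvature_metric by assumption.
assert (f0 : 0 < f (x 1%nat)) by (apply no_horizon, Hr).
assert (s0 : 0 < sin (x 2%nat)) by (apply sin_gt_0; lra).
assert (E0 := exp_pos (2 * Phi (x 1%nat))).
assert (pi0 := PI_RGT_0).
assert (i0 := Rinv_0_lt_compat _ f0).
unfold metric; cbv zeta; fold (f (x 1%nat)).
clearbody f df.
destruct a as [|[|[|[|a]]]]; try lia;
destruct b as [|[|[|[|b]]]]; try lia;
unfold fluid_frame;
try (unfold Rdiv; ring);
(* Only the diagonal entries remain, where the two frame factors multiply to [Rabs (g x a a)]. *)
rewrite sqrt_sqrt by apply Rabs_pos.
- rewrite Rabs_Ropp, Rabs_pos_eq by lra; field; repeat split; lra.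
- rewrite Rabs_pos_eq by lra; field; repeat split; lra.
- rewrite Rabs_pos_eq by apply pow2_ge_0; field; repeat split; lra.
- rewrite Rabs_pos_eq by (apply Rmult_le_pos; apply pow2_ge_0).
  field; repeat split; lra.
Qed.
End Static.

(* The conservation equation for [p_t] is the derivative of the equation for [Phi']. *)
Lemma sourced_by_TOV (Phi m p dm dp : R -> R) :
  (forall r, 0 < r ->
     is_derive Phi r ((m r + 4 * PI * r ^ 3 * p r) / (r * (r - 2 * m r)))) ->
  (forall r, 0 < r -> is_derive m r (dm r)) ->
  (forall r, 0 < r -> is_derive p r (dp r)) ->
  (forall r, 0 < r -> 0 < 1 - 2 * m r / r) ->
  sourced_by Phi m (fun r => dm r / (4 * PI * r ^ 2)) p
    (fun r => p r + r / 2 * (dp r + (dm r / (4 * PI * r ^ 2) + p r) *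
       ((m r + 4 * PI * r ^ 3 * p r) / (r * (r - 2 * m r))))).
Proof.
intros HPhi Hm Hp Hf.
set (P r := (m r + 4 * PI * r ^ 3 * p r) / (r * (r - 2 * m r))).
assert (den : forall r, 0 < r -> 0 < r - 2 * m r).
{ intros r Hr; specialize (Hf r Hr).
  replace (r - 2 * m r) with (r * (1 - 2 * m r / r)) by (field; lra).
  now apply Rmult_lt_0_compat. }
(* Quotient rule in the form (N' - P D') / D, with D = r (r - 2m) and D' = 2r - 2m - 2r m'. *)
set (dP r := ((dm r + 4 * PI * (3 * r ^ 2 * p r + r ^ 3 * dp r))
              - P r * (2 * r - 2 * m r - 2 * r * dm r)) / (r * (r - 2 * m r))).
assert (HP : forall r, 0 < r -> is_derive P r (dP r)).
{ intros r Hr.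
  assert (Dm := Hm r Hr). assert (Dp := Hp r Hr). assert (D := den r Hr).
  assert (r * (r - 2 * m r) <> 0) by (apply Rmult_integral_contrapositive; lra).
  unfold dP, P; auto_derive.
  - repeat split; try (eexists; eassumption); assumption.
  - replace (Derive (fun x => m x) r) with (dm r)
      by (symmetry; now apply is_derive_unique).
    replace (Derive (fun x => p x) r) with (dp r)
      by (symmetry; now apply is_derive_unique).
    field; lra. }
intros x Hr Hth a b Ha Hb.
rewrite (source_frame_metric Phi m P dm dP) by assumption.
assert (D := den _ Hr). assert (pi0 := PI_RGT_0).
cbv zeta; f_equal.
- field; lra.
- unfold P; field; lra.
- unfold dP, P; field; lra.
Qed.

(** * Mass and pressure profiles *)

Lemma ex_derive_continuous_R (f : R -> R) x : ex_derive f x -> continuous f x.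
Proof. exact (@ex_derive_continuous R_AbsRing R_NormedModule f x). Qed.

(** Away from 0 the function is locally zero or a plain power. At 0 the difference quotient is
    [h ^ n] for h > 0 and 0 for h < 0, which tends to 0 because n is at least 1. *)
Lemma is_derive_pos_part_pow (n : nat) (t : R) : (1 <= n)%nat ->
  is_derive (fun t => Rmax 0 t ^ S n) t (INR (S n) * Rmax 0 t ^ n).
Proof.
intros Hn.
destruct (Rtotal_order t 0) as [Ht | [-> | Ht]].
- apply (is_derive_ext_loc (fun _ => 0)).
  + generalize (open_lt 0 t Ht); apply filter_imp; intros u Hu.
    rewrite Rmax_left, pow_i by (lra || lia); reflexivity.
  + rewrite Rmax_left, pow_i, Rmult_0_r by (lra || lia).
    apply (@is_derive_const R_AbsRing R_NormedModule).
- rewrite Rmax_left, pow_i, Rmult_0_r by (lra || lia).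
  apply is_derive_Reals; intros e He.
  (* The bound 1 on h makes every power of h at most 1, so the quotient is at most h, and h < e. *)
  exists (mkposreal (Rmin 1 e) (Rmin_pos _ _ Rlt_0_1 He)); simpl; intros h Hh Hd.
  assert (H1 := Rmin_l 1 e); assert (H2 := Rmin_r 1 e).
  rewrite Rplus_0_l, (Rmax_left 0 0), Rmult_0_l, !Rminus_0_r by lra.
  destruct n as [|n]; [lia |].
  unfold Rmax; destruct (Rle_dec 0 h) as [H|H].
  + rewrite Rabs_pos_eq in Hd by lra.
    replace (h * h ^ S n / h) with (h * h ^ n) by (simpl; field; lra).
    rewrite Rabs_mult, (Rabs_pos_eq h), (Rabs_pos_eq (h ^ n))
      by (try apply pow_le; lra).
    assert (h ^ n <= 1) by (rewrite <- (pow1 n); apply pow_incr; lra).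
    apply Rle_lt_trans with (h * 1); [apply Rmult_le_compat_l; lra | lra].
  + unfold Rdiv; rewrite !Rmult_0_l, Rabs_R0; exact He.
- apply (is_derive_ext_loc (fun t => t ^ S n)).
  + generalize (open_gt 0 t Ht); apply filter_imp; intros u Hu.
    rewrite Rmax_right by lra; reflexivity.
  + rewrite Rmax_right by lra.
    apply is_derive_Reals, derivable_pt_lim_pow.
Qed.

(* [bump n] is [u ^ n * (1 - u) ^ n] cut off outside [0, 1]; its primitive extends
   [F n] to the whole line, so that [mass] needs no case distinction. *)
Definition bump (n : nat) (x : R) : R := Rmax 0 (s x) ^ n.

Lemma bump_ge0 n x : 0 <= bump n x.
Proof. apply pow_le, Rmax_l. Qed.

Lemma bump_le1 n x : bump n x <= 1.
Proof.
unfold bump; rewrite <- (pow1 n); apply pow_incr; split; [apply Rmax_l |].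
apply Rmax_lub; unfold s; nra.
Qed.

Lemma bump_in n x : 0 <= x <= 1 -> bump n x = s x ^ n.
Proof. intros Hx; unfold bump, s; rewrite Rmax_right; [easy | nra]. Qed.

Lemma bump_out n x : (1 <= n)%nat -> x <= 0 \/ 1 <= x -> bump n x = 0.
Proof. intros Hn Hx; unfold bump, s; rewrite Rmax_left, pow_i; [easy | lia | nra]. Qed.

(** The factor [s] in the radial pressure becomes one more order of vanishing at the wall edges,
    which makes [p_rad] differentiable there. Where [s x] is negative both sides vanish, as n is
    positive. *)
Lemma bump_mul_s n x : (1 <= n)%nat -> bump n x * s x = bump (S n) x.
Proof.
intros Hn; unfold bump, Rmax; destruct (Rle_dec 0 (s x)).
- simpl; ring.
- rewrite !pow_i by lia; ring.
Qed.

Lemma is_derive_bump n x : (1 <= n)%nat ->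
  is_derive (bump (S n)) x (INR (S n) * bump n x * (1 - 2 * x)).
Proof.
intros Hn.
replace (INR (S n) * bump n x * (1 - 2 * x))
  with ((1 - 2 * x) * (INR (S n) * bump n x)) by ring.
apply (is_derive_comp (fun t => Rmax 0 t ^ S n) s).
- now apply is_derive_pos_part_pow.
- unfold s; auto_derive; [easy | ring].
Qed.

Lemma continuous_bump n x : continuous (bump n) x.
Proof.
apply (continuous_comp (fun x => Rmax 0 (s x)) (fun t => t ^ n)).
- apply (continuous_ext (fun x => (s x + Rabs (s x)) / 2)).
  + intros u; unfold Rmax, Rabs; destruct (Rcase_abs _), (Rle_dec _ _); lra.
  + assert (C : continuous s x)
      by (apply ex_derive_continuous_R; unfold s; auto_derive; easy).
    apply (continuous_mult (fun x => s x + Rabs (s x)) (fun _ => / 2));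
      [| apply continuous_const].
    apply (continuous_plus s (fun x => Rabs (s x))); [exact C |].
    apply continuous_comp; [exact C | apply continuous_Rabs].
- apply ex_derive_continuous_R; auto_derive; easy.
Qed.

Lemma ex_RInt_bump n a b : ex_RInt (bump n) a b.
Proof. apply (@ex_RInt_continuous R_CompleteNormedModule); intros; apply continuous_bump. Qed.

Lemma RInt_bump_in n x : 0 <= x <= 1 ->
  RInt (fun u => u ^ n * (1 - u) ^ n) 0 x = RInt (bump n) 0 x.
Proof.
intros Hx; apply RInt_ext; intros u; rewrite Rmin_left, Rmax_right by lra; intros Hu.
rewrite bump_in by lra; unfold s; symmetry; apply Rpow_mult_distr.
Qed.

Lemma euler_beta_bump n : euler_beta (n + 1) (n + 1) = RInt (bump n) 0 1.
Proof.
rewrite <- RInt_bump_in by lra; unfold euler_beta.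
now replace (n + 1 - 1)%nat with n by lia.
Qed.

Lemma euler_beta_gt0 n : 0 < euler_beta (n + 1) (n + 1).
Proof.
rewrite euler_beta_bump; apply RInt_gt_0.
- lra.
- intros x Hx; rewrite bump_in by lra; apply pow_lt; unfold s; nra.
- intros; apply continuous_bump.
Qed.

Definition F_ext (n : nat) (x : R) : R := RInt (bump n) 0 x / euler_beta (n + 1) (n + 1).

Lemma is_derive_F_ext n x :
  is_derive (F_ext n) x (bump n x / euler_beta (n + 1) (n + 1)).
Proof.
unfold F_ext, Rdiv; rewrite Rmult_comm.
apply (is_derive_ext (fun x => / euler_beta (n + 1) (n + 1) * RInt (bump n) 0 x));
  [intros; apply Rmult_comm |].
apply is_derive_scal, (is_derive_RInt (bump n) _ 0).
- apply filter_forall; intros y; apply (@RInt_correct R_CompleteNormedModule), ex_RInt_bump.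
- apply continuous_bump.
Qed.

Lemma F_ext_in n x : 0 <= x <= 1 -> F_ext n x = F n x.
Proof. intros Hx; unfold F_ext, F; now rewrite RInt_bump_in. Qed.

Lemma RInt_zero_on (g : R -> R) a b : a <= b ->
  (forall x, a < x < b -> g x = 0) -> RInt g a b = 0.
Proof.
intros Hab Hg; rewrite (RInt_ext g (fun _ => 0)).
- rewrite RInt_const; apply Rmult_0_r.
- now rewrite Rmin_left, Rmax_right by lra.
Qed.

Lemma F_ext_left n x : (1 <= n)%nat -> x <= 0 -> F_ext n x = 0.
Proof.
intros Hn Hx; unfold F_ext.
rewrite <- opp_RInt_swap, RInt_zero_on.
- change (opp 0) with (- 0); unfold Rdiv; ring.
- exact Hx.
- intros u Hu; apply bump_out; [exact Hn | lra].
- apply ex_RInt_bump.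
Qed.

Lemma F_ext_right n x : (1 <= n)%nat -> 1 <= x -> F_ext n x = 1.
Proof.
intros Hn Hx; unfold F_ext.
rewrite <- (RInt_Chasles (bump n) 0 1 x) by apply ex_RInt_bump.
rewrite (RInt_zero_on _ 1 x), <- euler_beta_bump.
- change (plus (euler_beta (n + 1) (n + 1)) 0) with (euler_beta (n + 1) (n + 1) + 0).
  assert (H := euler_beta_gt0 n); field; lra.
- exact Hx.
- intros u Hu; apply bump_out; [exact Hn | lra].
Qed.

Lemma F_ext_ge0 n x : (1 <= n)%nat -> 0 <= F_ext n x.
Proof.
intros Hn; destruct (Rle_dec x 0) as [H|H].
- rewrite F_ext_left by assumption; lra.
- apply Rdiv_le_0_compat; [| apply euler_beta_gt0].
  apply RInt_ge_0; [lra | apply ex_RInt_bump | intros; apply bump_ge0].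
Qed.

(** Extreme value theorem, applied to [F_ext]: its derivative on the whole line gives two-sided
    continuity at the endpoints as well. *)
Lemma is_q_ex n eta : (1 <= n)%nat -> 1 < eta -> exists q, is_q n eta q.
Proof.
intros Hn Heta.
destruct (continuity_ab_maj (fun y => F_ext n ((y - 1) / (eta - 1)) / y) 1 eta)
  as [y [Hmax Hy]]; [lra | |].
- intros y Hy; apply continuity_pt_filterlim.
  assert (D := is_derive_F_ext n ((y - 1) / (eta - 1))).
  apply (ex_derive_continuous_R (fun y => F_ext n ((y - 1) / (eta - 1)) / y)).
  auto_derive; repeat split; try lra; eexists; exact D.
- assert (E : forall z, 1 <= z <= eta ->
    F n ((z - 1) / (eta - 1)) / z = F_ext n ((z - 1) / (eta - 1)) / z).
  { intros z Hz; rewrite F_ext_in; [easy |]; split.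
    - apply Rdiv_le_0_compat; lra.
    - apply Rle_div_l; lra. }
  exists (F_ext n ((y - 1) / (eta - 1)) / y); split.
  + now exists y; rewrite E.
  + intros z Hz; rewrite E by easy; auto.
Qed.

(** At y = eta the maximised quotient equals F(1) / eta = 1 / eta. *)
Lemma is_q_gt0 n eta q : (1 <= n)%nat -> 1 < eta -> is_q n eta q -> 0 < q.
Proof.
intros Hn Heta [_ Hq]; assert (H := Hq eta ltac:(lra)).
rewrite Rdiv_diag, <- F_ext_in, F_ext_right in H by (lra || lia).
apply Rlt_le_trans with (2 := H), Rdiv_lt_0_compat; lra.
Qed.

(** * ** Mass and radial pressure as functions of the radius *)

Section Profile.
Variables (n : nat) (eta L M : R).
Hypotheses (Hn : (1 <= n)%nat) (Heta : 1 < eta) (HL : 0 < L).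

Lemma wall_coord_le0 r : r <= L -> wall_coord eta L r <= 0.
Proof.
intros Hr; unfold wall_coord; apply Rle_div_l; [lra |].
rewrite Rmult_0_l; assert (r / L <= 1) by (apply Rle_div_l; lra); lra.
Qed.

Lemma wall_coord_ge1 r : eta * L <= r -> 1 <= wall_coord eta L r.
Proof.
intros Hr; unfold wall_coord; apply Rle_div_r; [lra |].
assert (eta <= r / L) by (apply Rle_div_r; lra); lra.
Qed.

Lemma wall_coord_in r : L < r < eta * L -> 0 < wall_coord eta L r < 1.
Proof.
intros Hr; unfold wall_coord.
assert (1 < r / L) by (apply Rlt_div_r; lra).
assert (r / L < eta) by (apply Rlt_div_l; lra).
split; [apply Rdiv_lt_0_compat; lra | apply Rlt_div_l; lra].
Qed.

Lemma is_derive_wall_coord r : is_derive (wall_coord eta L) r (/ (L * (eta - 1))).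
Proof. unfold wall_coord; auto_derive; [easy | field; lra]. Qed.

Lemma mass_F_ext r : mass n eta L M r = M * F_ext n (wall_coord eta L r).
Proof.
unfold mass; destruct (Rle_dec r L); [| destruct (Rlt_dec r (eta * L))].
- rewrite F_ext_left by (try apply wall_coord_le0; assumption); ring.
- assert (H := wall_coord_in r ltac:(lra)); rewrite F_ext_in; [easy | lra].
- rewrite F_ext_right by (try apply wall_coord_ge1; lra || assumption); ring.
Qed.

(** The constant in front of [bump] in m': the wall thickness [L * (eta - 1)] comes from dx/dr, the
    beta value from the normalisation of [F]. *)
Definition mass_scale : R := M / (L * (eta - 1) * euler_beta (n + 1) (n + 1)).

Lemma is_derive_mass r :
  is_derive (mass n eta L M) r (mass_scale * bump n (wall_coord eta L r)).
Proof.
assert (B := euler_beta_gt0 n).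
apply (is_derive_ext (fun r => M * F_ext n (wall_coord eta L r)));
  [intros; now rewrite mass_F_ext |].
replace (mass_scale * bump n (wall_coord eta L r)) with
  (M * (/ (L * (eta - 1)) *
    (bump n (wall_coord eta L r) / euler_beta (n + 1) (n + 1))))
  by (unfold mass_scale; field; lra).
apply is_derive_scal, (is_derive_comp (F_ext n)).
- apply is_derive_F_ext.
- apply is_derive_wall_coord.
Qed.

Lemma Derive_mass r :
  Derive (mass n eta L M) r = mass_scale * bump n (wall_coord eta L r).
Proof. apply is_derive_unique, is_derive_mass. Qed.

Lemma p_rad_bump eps r : p_rad n eta L M eps r =
  eps * mass_scale * bump (S n) (wall_coord eta L r) / (4 * PI * r ^ 2).
Proof.
unfold p_rad, rho; rewrite Derive_mass, <- bump_mul_s by exact Hn.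
unfold Rdiv; ring.
Qed.

(** Differentiating [bump (S n)] leaves a factor [bump n], that is, a factor [rho]. The derivative
    is stated with this factor in front so that [p_tan] becomes [rho] times a bounded ratio. *)
Lemma is_derive_p_rad eps r : 0 < r ->
  let x := wall_coord eta L r in
  is_derive (p_rad n eta L M eps) r
    (eps * rho n eta L M r *
      (INR (S n) * (1 - 2 * x) / (L * (eta - 1)) - 2 * s x / r)).
Proof.
intros Hr x.
apply (is_derive_ext (fun r =>
  eps * mass_scale / (4 * PI) * (bump (S n) (wall_coord eta L r) / r ^ 2)));
  [intros t; rewrite p_rad_bump; unfold Rdiv; rewrite !Rinv_mult; simpl; ring |].
assert (Dx := is_derive_wall_coord r).
assert (Db := is_derive_bump n x Hn).
assert (Dc := is_derive_comp (bump (S n)) (wall_coord eta L) r _ _ Db Dx).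
assert (Di : is_derive (fun r => / r ^ 2) r (- (2 / r ^ 3)))
  by (auto_derive; [simpl; nra | field; lra]).
assert (Dp := is_derive_scal _ r (eps * mass_scale / (4 * PI)) _
  (is_derive_mult _ _ r _ _ Dc Di Rmult_comm)).
match type of Dp with is_derive _ _ ?l => replace (eps * _ * _) with l end.
- exact Dp.
- unfold rho; rewrite Derive_mass; fold x; rewrite <- (bump_mul_s n x) by exact Hn.
  unfold scal, plus, mult; simpl; unfold mult; simpl.
  assert (P0 := PI_RGT_0); field; repeat split; lra.
Qed.

Lemma Derive_p_rad eps r : 0 < r ->
  let x := wall_coord eta L r in
  Derive (p_rad n eta L M eps) r =
    eps * rho n eta L M r *
      (INR (S n) * (1 - 2 * x) / (L * (eta - 1)) - 2 * s x / r).
Proof. intros Hr; apply is_derive_unique, is_derive_p_rad, Hr. Qed.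

Lemma mass_ge0 r : 0 <= M -> 0 <= mass n eta L M r.
Proof.
intros HM; rewrite mass_F_ext; apply Rmult_le_pos; [exact HM | now apply F_ext_ge0].
Qed.

(** In the wall this is the maximality of q at y = r / L. In the cavity the mass is zero, and
    outside it stays constant while the right-hand side grows from its value at y = eta. *)
Lemma mass_le q r : 0 <= M -> is_q n eta q -> 0 <= r -> mass n eta L M r <= M / L * q * r.
Proof.
intros HM Hq Hr; assert (q0 := is_q_gt0 n eta q Hn Heta Hq).
destruct Hq as [_ Hq].
assert (ML : 0 <= M / L) by (apply Rdiv_le_0_compat; lra).
assert (bound : forall y, 1 <= y <= eta -> F_ext n ((y - 1) / (eta - 1)) <= q * y).
{ intros y Hy; specialize (Hq y Hy).
  rewrite F_ext_in by (split; [apply Rdiv_le_0_compat | apply Rle_div_l]; lra).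
  apply Rle_div_l in Hq; lra. }
unfold mass; destruct (Rle_dec r L) as [H|H]; [| destruct (Rlt_dec r (eta * L)) as [H'|H']].
- apply Rmult_le_pos; [apply Rmult_le_pos |]; lra.
- assert (Hy := wall_coord_in r ltac:(lra)).
  rewrite <- F_ext_in by lra.
  replace (M / L * q * r) with (M * (q * (r / L))) by (field; lra).
  apply Rmult_le_compat_l; [exact HM |].
  apply bound; split; [apply Rle_div_r | apply Rle_div_l]; lra.
- specialize (bound eta ltac:(lra)).
  rewrite Rdiv_diag, F_ext_right in bound by (lra || lia).
  replace M with (M / L * L * 1) at 1 by (field; lra).
  replace (M / L * q * r) with (M / L * (q * r)) by ring.
  rewrite Rmult_assoc; apply Rmult_le_compat_l; [exact ML |]; nra.
Qed.
End Profile.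

(** * ADM mass *)

Section ADM.
Variables (m : R -> R) (M r0 : R).
Hypotheses (M_ge0 : 0 <= M) (r0_large : 2 * M < r0).
Hypothesis m_const : forall r, r0 <= r -> m r = M.

Lemma norm3_sq x : norm3 x ^ 2 = x 0%nat ^ 2 + x 1%nat ^ 2 + x 2%nat ^ 2.
Proof.
unfold norm3; apply pow2_sqrt.
assert (A := pow2_ge_0 (x 0%nat)); assert (B := pow2_ge_0 (x 1%nat));
assert (C := pow2_ge_0 (x 2%nat)); lra.
Qed.

Lemma is_derive_norm3 x k : 0 < norm3 x -> (k <= 2)%nat ->
  is_derive (fun t => norm3 (upd x k t)) (x k) (x k / norm3 x).
Proof.
intros Hx Hk.
assert (0 < x 0%nat ^ 2 + x 1%nat ^ 2 + x 2%nat ^ 2)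
  by (rewrite <- norm3_sq; now apply pow_lt).
unfold norm3 in *.
destruct k as [|[|[|k]]]; try lia; unfold upd; simpl Nat.eqb; cbv iota;
(auto_derive; [simpl in *; repeat split; lra | simpl in *; field; lra]).
Qed.

(** In the exterior [h] is the coefficient 1 / (1 - 2M/r) - 1 of [x i * x j / r ^ 2] in the spatial
    metric, and [dh] is its derivative. *)
Let dh r := - (2 * M) / (r - 2 * M) ^ 2.
Let h r := 2 * M / (r - 2 * M).
Let delta i j := if Nat.eqb i j then 1 else 0.

Lemma partial_spatial_metric x k i j : r0 < norm3 x ->
  (k <= 2)%nat -> (i <= 2)%nat -> (j <= 2)%nat ->
  partial k (fun y => spatial_metric m y i j) x =
  let r := norm3 x in
  dh r * (x k / r) * (x i * x j / r ^ 2)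
  + h r * ((delta k i * x j + delta k j * x i) / r ^ 2
           - 2 * (x i * x j * x k) / r ^ 4).
Proof.
intros Hr Hk Hi Hj; cbv zeta.
assert (Dr := is_derive_norm3 x k ltac:(lra) Hk).
unfold partial; apply is_derive_unique.
set (N t := norm3 (upd x k t)).
change (is_derive N (x k) (x k / norm3 x)) in Dr.
assert (N0 : N (x k) = norm3 x).
{ unfold N, norm3, upd; f_equal.
  destruct k as [|[|[|k]]]; try lia; reflexivity. }
(* The mass is known to be constant only beyond [r0], so the metric can be replaced by its exterior
   form only near [x]. *)
assert (near : locally (x k) (fun t => r0 < N t)).
{ apply (ex_derive_continuous N); [eexists; exact Dr |].
  apply (open_gt r0); now rewrite N0. }
apply (is_derive_ext_loc (fun t => delta i j
  + (/ (1 - 2 * M / N t) - 1) * (upd x k t i * upd x k t j / N t ^ 2))).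
{ generalize near; apply filter_imp; intros t Ht.
  unfold spatial_metric; fold (N t); rewrite m_const by lra; reflexivity. }
rewrite <- N0 in *; clearbody N.
assert (1 - 2 * M / N (x k) <> 0).
{ replace (1 - 2 * M / N (x k)) with ((N (x k) - 2 * M) / N (x k)) by (field; lra).
  apply Rgt_not_eq, Rdiv_lt_0_compat; lra. }
assert (ED := is_derive_unique _ _ _ Dr).
destruct k as [|[|[|k]]]; try lia;
destruct i as [|[|[|i]]]; try lia;
destruct j as [|[|[|j]]]; try lia;
unfold upd, delta, dh, h; simpl Nat.eqb; cbv iota;
(auto_derive;
 [repeat split; try (eexists; exact Dr); try assumption; apply Rgt_not_eq; simpl; nra |
  change (Derive (fun t => N t)) with (Derive N); rewrite ED;
  field; repeat split; lra]).
Qed.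

(** With unit radial vector n, the divergence of h n n has radial component h' + 2h/r, and the trace
    3 + h has radial derivative h'. The h' terms cancel. *)
Lemma adm_density_spatial_metric x : r0 < norm3 x ->
  adm_density (spatial_metric m) x = 2 * h (norm3 x) / norm3 x.
Proof.
intros Hr; unfold adm_density, sum_f_R0.
rewrite !partial_spatial_metric by (assumption || lia); cbv zeta.
assert (E : x 0%nat ^ 2 = norm3 x ^ 2 - x 1%nat ^ 2 - x 2%nat ^ 2)
  by (rewrite norm3_sq; ring).
unfold delta; simpl Nat.eqb; cbv iota.
generalize (dh (norm3 x)) (h (norm3 x)); intros a b.
assert (r_pos : norm3 x <> 0) by lra.
revert E r_pos.
generalize (norm3 x) (x 0%nat) (x 1%nat) (x 2%nat); intros r x0 x1 x2 E r_pos.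
(* [E] eliminates the square of the first coordinate; without it the polynomial identity fails. *)
field_simplify_eq; [ring [E] | exact r_pos].
Qed.

Lemma norm3_sphere_point r th ph : 0 <= r -> norm3 (sphere_point r th ph) = r.
Proof.
intros Hr; unfold norm3, sphere_point.
replace (_ + _) with (r ^ 2).
- rewrite <- Rsqr_pow2; now apply sqrt_Rsqr.
- assert (E1 := sin2_cos2 th); assert (E2 := sin2_cos2 ph); unfold Rsqr in *.
  replace ((r * sin th * cos ph) ^ 2 + (r * sin th * sin ph) ^ 2 + (r * cos th) ^ 2)
    with (r ^ 2 * (sin th * sin th * (sin ph * sin ph + cos ph * cos ph) + cos th * cos th))
    by ring.
  rewrite E2, Rmult_1_r, E1; ring.
Qed.

Lemma RInt_sin_0_PI : RInt sin 0 PI = 2.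
Proof.
apply is_RInt_unique.
replace 2 with (minus ((fun t => - cos t) PI) ((fun t => - cos t) 0)).
- apply (is_RInt_derive (fun t => - cos t)); intros t _.
  + auto_derive; [easy | ring].
  + apply ex_derive_continuous_R; auto_derive; easy.
- unfold minus, plus, opp; simpl; rewrite cos_PI, cos_0; ring.
Qed.

(** The density is constant on the sphere, so the flux is the area 4 pi r^2 times 2h/r. *)
Lemma adm_flux_spatial_metric r : r0 < r ->
  adm_flux (spatial_metric m) r = 16 * PI * M * (r / (r - 2 * M)).
Proof.
intros Hr; unfold adm_flux.
rewrite (RInt_ext _ (fun th => 4 * PI * r * h r * sin th)).
- assert (E : ex_RInt sin 0 PI).
  { apply (@ex_RInt_continuous R_CompleteNormedModule); intros t _.
    apply ex_derive_continuous_R; auto_derive; easy. }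
  apply (@eq_trans R _ (4 * PI * r * h r * RInt sin 0 PI));
    [exact (RInt_scal sin 0 PI (4 * PI * r * h r) E) |].
  rewrite RInt_sin_0_PI; unfold h; field; lra.
- intros th _.
  rewrite (RInt_ext _ (fun _ => 2 * h r / r * (r ^ 2 * sin th))).
  + rewrite RInt_const; unfold scal; simpl; unfold mult; simpl; field; lra.
  + intros ph _; rewrite adm_density_spatial_metric;
      rewrite norm3_sphere_point; lra.
Qed.

Lemma has_adm_mass_of_const : has_adm_mass m M.
Proof.
unfold has_adm_mass.
(* Dividing r / (r - 2M) through by r leaves 1 / r as the only varying quantity. *)
apply (is_lim_ext_loc (fun r => M * / (1 - 2 * M * / r))).
- exists r0; intros r Hr; rewrite adm_flux_spatial_metric by exact Hr.
  assert (P0 := PI_RGT_0); field; repeat split; lra.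
- replace (Finite M) with (Finite (M * / (1 - 2 * M * 0))) by (f_equal; field; lra).
  apply (is_lim_scal_l (fun r => / (1 - 2 * M * / r)) M p_infty (/ (1 - 2 * M * 0))).
  apply (is_lim_inv (fun r => 1 - 2 * M * / r) p_infty (1 - 2 * M * 0)).
  + apply (is_lim_minus (fun _ => 1) _ p_infty 1 (2 * M * 0)); [apply is_lim_const | | easy].
    apply (is_lim_scal_l Rinv (2 * M) p_infty 0).
    apply (is_lim_inv (fun r => r) p_infty p_infty); [apply is_lim_id | easy].
  + rewrite Rmult_0_r, Rminus_0_r; intros E; injection E; lra.
Qed.
End ADM.

(** * The shell *)

(** Here a and b are the ratios of the radial and tangential pressures to the density. The tightest
    sum is the SEC one: 1 + a + 2b is at least 1 - 1/4 - 1/2 = 1/4. *)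
Lemma energy_conditions_of_ratio rho_ a b :
  0 <= rho_ -> -(1 / 4) <= a <= 1 / 4 -> -(1 / 4) <= b <= 1 ->
  NEC rho_ (rho_ * a) (rho_ * b) /\ WEC rho_ (rho_ * a) (rho_ * b) /\
  SEC rho_ (rho_ * a) (rho_ * b) /\ DEC rho_ (rho_ * a) (rho_ * b).
Proof.
intros Hr Ha Hb.
assert (N : NEC rho_ (rho_ * a) (rho_ * b)) by (split; nra).
split; [exact N | split; [now split | split]].
- split; [exact N | nra].
- split; apply Rabs_le; nra.
Qed.

(* At [eps = 0] the ratio is [w / (2 (1 - 2 w))], increasing in [w] and equal to
   [1] at [w = 2/5]; the remaining terms are [O(eps)]. *)
Lemma tangential_ratio_bound eps sx w w0 k K t T :
  0 <= sx <= 1 / 4 -> 0 <= w <= w0 -> w0 < 4 / 10 -> 0 <= k <= K ->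
  Rabs t <= T -> Rabs eps <= 1 ->
  Rabs eps * (T + 1 + K) <= Rmin (1 / 4) (1 - w0 / (2 * (1 - 2 * w0))) ->
  -(1 / 4) <= eps * t + (1 + eps * sx) / 2 * ((w + eps * k * sx) / (1 - 2 * w)) <= 1.
Proof.
intros Hs Hw Hw0 Hk Ht He Hmin.
assert (H1 := Rmin_l (1 / 4) (1 - w0 / (2 * (1 - 2 * w0)))).
assert (H2 := Rmin_r (1 / 4) (1 - w0 / (2 * (1 - 2 * w0)))).
set (v := / (1 - 2 * w)).
(* From w < 2/5 one gets 1 - 2w > 1/5. *)
assert (v_bound : 0 < v <= 5).
{ unfold v; split; [apply Rinv_0_lt_compat; lra |].
  rewrite <- (Rinv_inv 5); apply Rinv_le_contravar; lra. }
assert (w_mono : w * v / 2 <= w0 / (2 * (1 - 2 * w0))).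
{ unfold v; replace (w * / (1 - 2 * w) / 2) with (w / (2 * (1 - 2 * w))) by (field; lra).
  apply Rle_div_l; [lra |].
  replace (w0 / (2 * (1 - 2 * w0)) * (2 * (1 - 2 * w)))
    with (w0 * (1 - 2 * w) / (1 - 2 * w0)) by (field; lra).
  apply Rle_div_r; nra. }
assert (0 <= w * v) by nra.
(* The whole correction to the ratio w v / 2 at [eps = 0] is [eps * e]. *)
set (e := t + (sx * w + (1 + eps * sx) * (k * sx)) * v / 2).
replace (eps * t + _) with (w * v / 2 + eps * e) by (unfold e, v; field; lra).
assert (e_bound : Rabs e <= T + 1 + K).
{ unfold e; apply Rle_trans with (1 := Rabs_triang _ _).
  (* With v / 2 at most 5/2, the two summands are at most 1/4 and 25K/32. *)
  assert (B1 : Rabs ((sx * w + (1 + eps * sx) * (k * sx)) * v / 2) <= 1 + K).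
  { apply Rabs_le_between in He.
    assert (0 <= sx * w <= 1 / 10) by nra.
    assert (0 <= k * sx <= K / 4) by nra.
    assert (0 <= 1 + eps * sx <= 5 / 4) by nra.
    assert (0 <= (1 + eps * sx) * (k * sx) <= 5 / 16 * K) by nra.
    apply Rabs_le; nra. }
  lra. }
assert (ee : Rabs (eps * e) <= Rabs eps * (T + 1 + K)).
{ rewrite Rabs_mult; apply Rmult_le_compat_l; [apply Rabs_pos | exact e_bound]. }
(* The first argument of the minimum gives the lower bound, since w v is nonnegative; the second
   gives the upper bound. *)
apply Rabs_le_between in ee; lra.
Qed.

Lemma continuous_mult_R (f g : R -> R) r :
  continuous f r -> continuous g r -> continuous (fun r => f r * g r) r.
Proof. exact (@continuous_mult R_UniformSpace R_AbsRing f g r). Qed.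

Lemma no_jump_continuous f r0 : continuous f r0 -> no_jump f r0.
Proof.
intros Hf; exists (f r0); split; apply (filterlim_filter_le_1 (F := locally r0) f); try exact Hf;
apply filter_le_within.
Qed.

Section Shell.
Variables (n : nat) (eta L M q eps : R).
Hypotheses (Hn : (1 <= n)%nat) (Heta : 1 < eta) (HL : 0 < L) (HM : 0 < M).
Hypotheses (Hq : is_q n eta q) (compactness : M / L * q < 4 / 10).

Let m := mass n eta L M.
Let p := p_rad n eta L M eps.
Let psi := dPhi n eta L M eps.
Let x := wall_coord eta L.

Lemma mass_lt r : 0 < r -> m r < 4 / 10 * r.
Proof.
intros Hr; assert (H := mass_le n eta L M Hn Heta HL q r ltac:(lra) Hq ltac:(lra)).
unfold m; nra.
Qed.

Lemma horizon_free_mass : horizon_free m.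
Proof.
intros r Hr; assert (H := mass_lt r Hr).
replace (1 - 2 * m r / r) with ((r - 2 * m r) / r) by (field; lra).
apply Rdiv_lt_0_compat; lra.
Qed.

Lemma mass_cavity r : r <= L -> m r = 0.
Proof. intros Hr; unfold m, mass; destruct (Rle_dec r L); lra. Qed.

Lemma wall_radii : 0 < L < eta * L.
Proof. nra. Qed.

Lemma mass_exterior r : eta * L <= r -> m r = M.
Proof.
assert (W := wall_radii); intros Hr; unfold m, mass.
destruct (Rle_dec r L); [lra | destruct (Rlt_dec r (eta * L)); lra].
Qed.

Lemma exterior_large r : eta * L <= r -> 2 * M < r.
Proof.
assert (W := wall_radii); intros Hr; assert (H := mass_lt r ltac:(lra)).
rewrite mass_exterior in H; lra.
Qed.

Lemma bump_vacuum k r : (1 <= k)%nat -> r <= L \/ eta * L <= r -> bump k (x r) = 0.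
Proof.
intros Hk [Hr | Hr]; apply bump_out; try exact Hk.
- left; now apply wall_coord_le0.
- right; now apply wall_coord_ge1.
Qed.

Lemma rho_vacuum r : r <= L \/ eta * L <= r -> rho n eta L M r = 0.
Proof.
intros Hr; unfold rho; rewrite Derive_mass by assumption; fold x.
rewrite bump_vacuum by assumption; unfold Rdiv; ring.
Qed.

Lemma p_rad_vacuum r : r <= L \/ eta * L <= r -> p r = 0.
Proof. intros Hr; unfold p, p_rad; rewrite rho_vacuum by exact Hr; ring. Qed.

(** * ** The gravitational potential *)

Lemma dPhi_cavity r : r <= L -> psi r = 0.
Proof.
intros Hr; unfold psi, dPhi; fold m p.
rewrite mass_cavity, p_rad_vacuum by auto; unfold Rdiv; ring.
Qed.

Lemma dPhi_exterior r : eta * L <= r -> psi r = M / (r * (r - 2 * M)).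
Proof.
intros Hr; unfold psi, dPhi; fold m p.
rewrite mass_exterior, p_rad_vacuum by auto; f_equal; ring.
Qed.

(** Below L the function is identically zero, which also covers r <= 0, where the quotient
    degenerates. From L on the denominator is positive and both [mass] and [p_rad] are
    differentiable, edges included. *)
Lemma continuous_dPhi r : continuous psi r.
Proof.
destruct (Rlt_dec r L) as [Hr | Hr].
- apply (continuous_ext_loc _ (fun _ => 0)); [| apply continuous_const].
  generalize (open_lt L r Hr); apply filter_imp; intros t Ht.
  symmetry; apply dPhi_cavity; lra.
- assert (r0 : 0 < r) by lra.
  assert (Dm := is_derive_mass n eta L M Hn Heta HL r).
  assert (Dp := is_derive_p_rad n eta L M Hn Heta HL eps r r0).
  assert (H := mass_lt r r0); unfold m in H.
  apply ex_derive_continuous_R; unfold psi, dPhi.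
  auto_derive; repeat split; try (eexists; eassumption).
  apply Rgt_not_eq; apply Rmult_lt_0_compat; lra.
Qed.

Definition schwarzschild_potential (r : R) : R := ln (1 - 2 * M / r) / 2.

Lemma is_derive_schwarzschild_potential r : 2 * M < r ->
  is_derive schwarzschild_potential r (M / (r * (r - 2 * M))).
Proof.
intros Hr.
assert (0 < 1 - 2 * M / r).
{ replace (1 - 2 * M / r) with ((r - 2 * M) / r) by (field; lra).
  apply Rdiv_lt_0_compat; lra. }
unfold schwarzschild_potential; auto_derive; [repeat split; lra |].
field; repeat split; lra.
Qed.

Lemma is_lim_schwarzschild_potential : is_lim schwarzschild_potential p_infty 0.
Proof.
unfold schwarzschild_potential.
replace 0 with (ln (1 - 2 * M * 0) / 2)
  by (rewrite Rmult_0_r, Rminus_0_r, ln_1; lra).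
apply (is_lim_comp_continuous (fun r => 1 - 2 * M / r) (fun y => ln y / 2)).
- apply (is_lim_minus (fun _ => 1) _ p_infty 1 (2 * M * 0)); [apply is_lim_const | | easy].
  apply (is_lim_scal_l Rinv (2 * M) p_infty 0).
  apply (is_lim_inv (fun r => r) p_infty p_infty); [apply is_lim_id | easy].
- apply ex_derive_continuous_R; auto_derive; lra.
Qed.

(** Both functions have the same derivative in the exterior, so only one additive constant is left
    for the condition at infinity to fix. *)
Lemma potential_exterior Phi r :
  (forall r, 0 < r -> is_derive Phi r (psi r)) -> eta * L <= r ->
  Phi r - schwarzschild_potential r
  = Phi (eta * L) - schwarzschild_potential (eta * L).
Proof.
assert (W := wall_radii).
intros HPhi [Hr | <-]; [| easy]; symmetry.
apply (eq_is_derive (fun r => Phi r - schwarzschild_potential r)); [| exact Hr].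
intros t Ht.
replace (@zero R_NormedModule) with (psi t - M / (t * (t - 2 * M)))
  by (rewrite dPhi_exterior by lra; apply Rminus_diag).
apply (is_derive_minus Phi schwarzschild_potential).
- apply HPhi; lra.
- apply is_derive_schwarzschild_potential, exterior_large; lra.
Qed.

Lemma potential_ex : exists Phi, is_potential n eta L M eps Phi.
Proof.
assert (W := wall_radii).
(* Matching the Schwarzschild value at the outer edge makes the two potentials agree in the whole
   exterior, hence gives the limit 0. *)
set (Phi r := schwarzschild_potential (eta * L) + RInt psi (eta * L) r).
assert (HPhi : forall r, is_derive Phi r (psi r)).
{ intros r; replace (psi r) with (0 + psi r) by ring.
  apply (is_derive_plus (fun _ => schwarzschild_potential (eta * L)) (RInt psi (eta * L))).
  - apply (@is_derive_const R_AbsRing R_NormedModule).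
  - apply (is_derive_RInt psi _ (eta * L)).
    + apply filter_forall; intros y.
      apply (@RInt_correct R_CompleteNormedModule).
      apply (@ex_RInt_continuous R_CompleteNormedModule); intros.
      apply continuous_dPhi.
    + apply continuous_dPhi. }
exists Phi; split; [auto | split].
- apply (filterlim_filter_le_1 (F := locally 0) Phi); [apply filter_le_within |].
  apply ex_derive_continuous_R; eexists; apply HPhi.
- apply (is_lim_ext_loc schwarzschild_potential); [| apply is_lim_schwarzschild_potential].
  exists (eta * L); intros r Hr.
  assert (E := potential_exterior Phi r (fun r _ => HPhi r) ltac:(lra)).
  assert (E0 : Phi (eta * L) = schwarzschild_potential (eta * L)).
  { unfold Phi; rewrite RInt_point; apply Rplus_0_r. }
  lra.
Qed.

Lemma potential_schwarzschild Phi : is_potential n eta L M eps Phi ->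
  exactly_schwarzschild Phi m M (eta * L).
Proof.
assert (W := wall_radii).
intros [HPhi [_ Hlim]] r Hr; split; [now apply mass_exterior |].
(* The constant difference in the exterior is its own limit at infinity, and both potentials tend to
   0. *)
assert (c0 : Phi (eta * L) - schwarzschild_potential (eta * L) = 0).
{ assert (H : is_lim (fun _ => Phi (eta * L) - schwarzschild_potential (eta * L)) p_infty 0).
  { apply (is_lim_ext_loc (fun r => Phi r - schwarzschild_potential r)).
    - exists (eta * L); intros t Ht; apply potential_exterior; [exact HPhi | lra].
    - replace 0 with (0 - 0) by ring.
      apply (is_lim_minus Phi _ p_infty 0 0); [exact Hlim | | easy].
      apply is_lim_schwarzschild_potential. }
  apply is_lim_unique in H; rewrite Lim_const in H; now injection H. }
assert (E := potential_exterior Phi r HPhi Hr).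
assert (Hr2 := exterior_large r Hr).
replace (2 * Phi r) with (ln (1 - 2 * M / r))
  by (unfold schwarzschild_potential in *; lra).
apply exp_ln.
replace (1 - 2 * M / r) with ((r - 2 * M) / r) by (field; lra).
apply Rdiv_lt_0_compat; lra.
Qed.

Lemma potential_cavity Phi : is_potential n eta L M eps Phi -> flat_cavity Phi m L.
Proof.
intros [HPhi [Hcenter _]]; split; [intros; apply mass_cavity; lra |].
assert (cst : forall r, 0 < r <= L -> Phi r = Phi L).
{ intros r [r0 [Hr | ->]]; [| easy].
  apply (eq_is_derive Phi); [| exact Hr].
  intros t Ht; change (@zero R_NormedModule) with 0.
  rewrite <- (dPhi_cavity t) by lra; apply HPhi; lra. }
exists (Phi L); intros r [[r0 | <-] Hr]; [auto |].
(* The derivative says nothing at the centre; right-continuity forces the value there to be the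
   constant found on [(0, L]]. *)
apply (@filterlim_locally_unique R R_AbsRing R_NormedModule (at_right 0) _ Phi).
- exact Hcenter.
- apply (filterlim_ext_loc (fun _ => Phi L)); [| apply filterlim_const].
  exists (mkposreal L HL); intros t Ht t0; symmetry; apply cst.
  unfold ball in Ht; simpl in Ht; unfold AbsRing_ball, abs, minus, plus, opp in Ht.
  simpl in Ht; rewrite Rabs_pos_eq in Ht; lra.
Qed.

(** All components are continuous at every positive radius, so the one-sided limits coincide. The
    delicate one is the tau-tau extrinsic curvature, which contains Phi' and relies on
    [continuous_dPhi]. *)
Lemma junction_free_shell Phi r0 : 0 < r0 ->
  is_potential n eta L M eps Phi -> junction_free_at Phi m r0.
Proof.
intros Hr0 [HPhi _] y a b Ha Hb.
assert (CPhi : continuous (fun r => exp (2 * Phi r)) r0).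
{ assert (D := HPhi r0 Hr0); apply ex_derive_continuous_R; auto_derive.
  eexists; exact D. }
assert (Cf : continuous (fun r => sqrt (1 - 2 * m r / r)) r0).
{ assert (D := is_derive_mass n eta L M Hn Heta HL r0); fold m in D.
  apply (continuous_comp (fun r => 1 - 2 * m r / r) sqrt).
  - apply ex_derive_continuous_R; auto_derive; split; [eexists; exact D | lra].
  - apply continuous_sqrt. }
assert (CD : continuous (Derive Phi) r0).
{ apply (continuous_ext_loc _ psi); [| apply continuous_dPhi].
  generalize (open_gt 0 r0 Hr0); apply filter_imp; intros t Ht.
  symmetry; now apply is_derive_unique, HPhi. }
assert (Cr : forall c, continuous (fun r => r ^ 2 * c) r0)
  by (intros c; apply ex_derive_continuous_R; auto_derive; easy).
assert (Crf : continuous (fun r => r * sqrt (1 - 2 * m r / r)) r0)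
  by (apply (continuous_mult_R (fun r => r)); [apply continuous_id | exact Cf]).
split; apply no_jump_continuous;
destruct a as [|[|[|[|a]]]]; try easy;
destruct b as [|[|[|[|b]]]]; try easy;
unfold metric, extrinsic, upd; simpl Nat.eqb; cbv iota zeta;
try apply continuous_const.
- now apply (continuous_opp (fun r => exp (2 * Phi r))).
- apply (continuous_ext (fun r => r ^ 2 * 1)); [intros; apply Rmult_1_r | apply Cr].
- apply Cr.
- apply (continuous_mult_R (fun r => - exp (2 * Phi r) * sqrt (1 - 2 * m r / r)));
    [| exact CD].
  apply (continuous_mult_R (fun r => - exp (2 * Phi r))); [| exact Cf].
  now apply (continuous_opp (fun r => exp (2 * Phi r))).
- apply (continuous_mult_R (fun _ => sin (y 2%nat) ^ 2)); [apply continuous_const | exact Crf].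
Qed.

Lemma sourced_by_shell Phi : is_potential n eta L M eps Phi ->
  sourced_by Phi m (rho n eta L M) p (p_tan n eta L M eps).
Proof.
intros [HPhi _].
assert (Dm : forall r, is_derive m r (Derive m r)).
{ intros r; apply Derive_correct; eexists; now apply is_derive_mass. }
assert (Dp : forall r, 0 < r -> is_derive p r (Derive p r)).
{ intros r Hr; apply Derive_correct; eexists; now apply is_derive_p_rad. }
exact (sourced_by_TOV Phi m p (Derive m) (Derive p) HPhi (fun r _ => Dm r) Dp
         horizon_free_mass).
Qed.

Lemma p_rad_wall r : L < r < eta * L -> eps <> 0 -> p r <> 0.
Proof.
intros Hr He; unfold p; rewrite p_rad_bump by assumption; fold x.
assert (Hx := wall_coord_in eta L Heta HL r Hr); fold x in Hx.
assert (P0 := PI_RGT_0); assert (B0 := euler_beta_gt0 n).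
assert (b0 : 0 < bump (S n) (x r)).
{ rewrite bump_in by lra; apply pow_lt; unfold s; nra. }
assert (K0 : 0 < mass_scale n eta L M).
{ unfold mass_scale; apply Rdiv_lt_0_compat; [exact HM |].
  apply Rmult_lt_0_compat; [apply Rmult_lt_0_compat |]; lra. }
unfold Rdiv; rewrite 2!Rmult_assoc.
apply Rmult_integral_contrapositive_currified; [exact He |].
apply Rgt_not_eq, Rmult_lt_0_compat; [exact K0 |].
apply Rdiv_lt_0_compat; [exact b0 |].
apply Rmult_lt_0_compat; [lra | apply pow_lt; lra].
Qed.

(** * ** Energy conditions in the shell *)

Lemma rho_ge0 r : 0 <= rho n eta L M r.
Proof.
destruct (Req_dec r 0) as [-> | r0].
- rewrite rho_vacuum; lra.
- unfold rho; rewrite Derive_mass by assumption.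
  assert (P0 := PI_RGT_0); assert (B0 := euler_beta_gt0 n).
  apply Rdiv_le_0_compat.
  + apply Rmult_le_pos; [| apply bump_ge0].
    apply Rdiv_le_0_compat; [lra |].
    apply Rmult_lt_0_compat; [apply Rmult_lt_0_compat |]; lra.
  + assert (0 < r ^ 2) by (apply pow2_gt_0, r0); nra.
Qed.

(** Since m' = 4 pi r^2 rho, the pressure term of Phi' is m' times eps s. Writing the result as a
    product avoids dividing by [rho], which vanishes outside the wall. *)
Lemma p_tan_ratio r : 0 < r ->
  p_tan n eta L M eps r = rho n eta L M r *
    (eps * (INR (S n) / 2 * (1 - 2 * x r) * (r / L / (eta - 1)))
     + (1 + eps * s (x r)) / 2 *
       ((m r / r + eps * (mass_scale n eta L M * bump n (x r)) * s (x r))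
        / (1 - 2 * (m r / r)))).
Proof.
intros Hr; unfold p_tan; rewrite Derive_p_rad by assumption; fold x.
assert (K : mass_scale n eta L M * bump n (x r) = 4 * PI * r ^ 2 * rho n eta L M r).
{ unfold rho; rewrite Derive_mass by assumption; fold x.
  assert (P0 := PI_RGT_0); field; lra. }
rewrite K; unfold dPhi, p_rad; fold m x.
assert (H := mass_lt r Hr).
field; repeat split; lra.
Qed.

Lemma p_tan_vacuum r : 0 <= r -> r <= L \/ eta * L <= r ->
  p_tan n eta L M eps r = 0.
Proof.
intros [Hr | <-] V.
- rewrite p_tan_ratio, rho_vacuum by assumption; ring.
(* At the centre the factor r / 2 removes the bracket, whatever its conventional value. *)
- unfold p_tan; fold p; rewrite p_rad_vacuum by exact V; lra.
Qed.

(** The smallness condition is that of [tangential_ratio_bound] with w0 = (M/L) q, T = (n+1)/2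
    eta/(eta-1) and K = (M/L) / ((eta-1) B). L and M enter only through M/L. *)
Lemma energy_conditions_shell r : 0 <= r -> Rabs eps <= 1 ->
  Rabs eps * (INR (S n) / 2 * (eta / (eta - 1)) + 1
    + M / L / ((eta - 1) * euler_beta (n + 1) (n + 1)))
  <= Rmin (1 / 4) (1 - M / L * q / (2 * (1 - 2 * (M / L * q)))) ->
  let r_ := rho n eta L M r in
  let pr := p_rad n eta L M eps r in
  let pt := p_tan n eta L M eps r in
  NEC r_ pr pt /\ WEC r_ pr pt /\ SEC r_ pr pt /\ DEC r_ pr pt.
Proof.
intros Hr He Hmin; cbv zeta.
assert (r_0 := rho_ge0 r).
assert (vacuum : r <= L \/ eta * L <= r ->
  NEC (rho n eta L M r) (p r) (p_tan n eta L M eps r) /\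
  WEC (rho n eta L M r) (p r) (p_tan n eta L M eps r) /\
  SEC (rho n eta L M r) (p r) (p_tan n eta L M eps r) /\
  DEC (rho n eta L M r) (p r) (p_tan n eta L M eps r)).
{ intros V; rewrite rho_vacuum, p_rad_vacuum, p_tan_vacuum by assumption.
  generalize (energy_conditions_of_ratio 0 0 0); rewrite Rmult_0_l; intros H.
  apply H; lra. }
destruct (Rlt_dec L r) as [HLr | HLr];
  [destruct (Rlt_dec r (eta * L)) as [HrR | HrR] |].
- rewrite p_tan_ratio by lra.
  replace (p_rad n eta L M eps r) with (rho n eta L M r * (eps * s (x r)))
    by (unfold p_rad; fold x; ring).
  assert (Hx := wall_coord_in eta L Heta HL r ltac:(lra)); fold x in Hx.
  assert (Hs : 0 <= s (x r) <= 1 / 4)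
    by (unfold s; assert (Q := pow2_ge_0 (x r - / 2)); nra).
  assert (He' := proj1 (Rabs_le_between _ _) He).
  apply energy_conditions_of_ratio; [exact r_0 | nra |].
  eapply tangential_ratio_bound; try exact Hmin; try assumption.
  + split.
    * apply Rdiv_le_0_compat; [apply mass_ge0; assumption || lra | lra].
    * apply Rle_div_l; [lra |]; apply mass_le; assumption || lra.
  + assert (B0 := euler_beta_gt0 n).
    assert (K0 : 0 <= mass_scale n eta L M).
    { unfold mass_scale; apply Rdiv_le_0_compat; [lra |].
      apply Rmult_lt_0_compat; [apply Rmult_lt_0_compat |]; lra. }
    (* This is K; it bounds m' in the wall because [bump] is at most 1. *)
    replace (M / L / _) with (mass_scale n eta L M)
      by (unfold mass_scale; field; lra).
    assert (b0 := bump_ge0 n (x r)); assert (b1 := bump_le1 n (x r)); nra.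
  (* The bound T uses |1 - 2x| <= 1 and r / L <= eta in the wall. *)
  + rewrite 2!Rabs_mult, (Rabs_pos_eq (_ / 2)), (Rabs_pos_eq (_ / (eta - 1))).
    * assert (N0 := pos_INR (S n)).
      assert (E : r / L <= eta) by (apply Rle_div_l; lra).
      assert (R0 : 0 <= r / L) by (apply Rdiv_le_0_compat; lra).
      assert (Rabs (1 - 2 * x r) <= 1) by (apply Rabs_le; lra).
      rewrite <- (Rmult_1_r (INR (S n) / 2)) at 2.
      apply Rmult_le_compat; try lra.
      -- apply Rmult_le_pos; [lra | apply Rabs_pos].
      -- apply Rdiv_le_0_compat; lra.
      -- apply Rmult_le_compat_l; lra.
      -- apply Rmult_le_compat_r; [apply Rlt_le, Rinv_0_lt_compat |]; lra.
    * apply Rdiv_le_0_compat; [apply Rdiv_le_0_compat |]; lra.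
    * assert (N0 := pos_INR (S n)); lra.
- apply vacuum; lra.
- apply vacuum; lra.
Qed.
End Shell.

Theorem theorem9 :
  forall (n : nat) (eta : R), (1 <= n)%nat -> 1 < eta ->
  exists q : R, is_q n eta q /\
  forall mu : R, 0 < mu -> mu < 4 / 10 / q ->
  exists eps_star : R, 0 < eps_star /\
  forall L M : R, 0 < L -> 0 < M -> mu = M / L ->
  forall eps : R,
    (exists Phi : R -> R, is_potential n eta L M eps Phi) /\
    (eps <> 0 -> forall r, L < r < eta * L -> p_rad n eta L M eps r <> 0) /\
    (forall Phi : R -> R, is_potential n eta L M eps Phi ->
       sourced_by Phi (mass n eta L M) (rho n eta L M)
         (p_rad n eta L M eps) (p_tan n eta L M eps) /\
       flat_cavity Phi (mass n eta L M) L /\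
       exactly_schwarzschild Phi (mass n eta L M) M (eta * L) /\
       has_adm_mass (mass n eta L M) M /\
       (Rabs eps < eps_star ->
          horizon_free (mass n eta L M) /\
          junction_free_at Phi (mass n eta L M) L /\
          junction_free_at Phi (mass n eta L M) (eta * L) /\
          (forall r, 0 <= r ->
             NEC (rho n eta L M r) (p_rad n eta L M eps r) (p_tan n eta L M eps r) /\
             WEC (rho n eta L M r) (p_rad n eta L M eps r) (p_tan n eta L M eps r) /\
             SEC (rho n eta L M r) (p_rad n eta L M eps r) (p_tan n eta L M eps r) /\
             DEC (rho n eta L M r) (p_rad n eta L M eps r) (p_tan n eta L M eps r)))).
Proof.
intros n eta Hn Heta.
destruct (is_q_ex n eta Hn Heta) as [q Hq]; exists q; split; [exact Hq |].
assert (q0 := is_q_gt0 n eta q Hn Heta Hq).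
intros mu mu0 Hmu; apply Rlt_div_r in Hmu; [| exact q0].
assert (muq : 0 < mu * q) by now apply Rmult_lt_0_compat.
(* [A] bounds the coefficient of eps in p_t / rho, and [d] is the room left by the ratio at
   [eps = 0]. Both depend on L and M only through mu, so the threshold min(1, d/A) can be chosen
   before them. *)
set (A := INR (S n) / 2 * (eta / (eta - 1)) + 1
          + mu / ((eta - 1) * euler_beta (n + 1) (n + 1))).
set (d := Rmin (1 / 4) (1 - mu * q / (2 * (1 - 2 * (mu * q))))).
assert (d0 : 0 < d).
{ apply Rmin_pos; [lra |].
  (* For w < 1/2, the inequality w / (2 (1 - 2w)) < 1 amounts to w < 2/5, which is where the
     constant 0.4 comes from. *)
  assert (mu * q / (2 * (1 - 2 * (mu * q))) < 1) by (apply Rlt_div_l; lra); lra. }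
assert (A0 : 0 < A).
{ assert (B0 := euler_beta_gt0 n).
  assert (0 <= INR (S n) / 2 * (eta / (eta - 1))).
  { apply Rmult_le_pos; apply Rdiv_le_0_compat; try lra; apply pos_INR. }
  assert (0 < mu / ((eta - 1) * euler_beta (n + 1) (n + 1))).
  { apply Rdiv_lt_0_compat; [| apply Rmult_lt_0_compat]; lra. }
  unfold A; lra. }
exists (Rmin 1 (d / A)); split; [apply Rmin_pos; [lra | now apply Rdiv_lt_0_compat] |].
intros L M HL HM -> eps; split; [| split].
- now apply potential_ex with q.
- intros He r Hr; now apply p_rad_wall.
- intros Phi HPhi; split; [| split; [| split; [| split]]].
  + now apply sourced_by_shell with q.
  + now apply potential_cavity with eps.
  + now apply potential_schwarzschild with q eps.
  + apply (has_adm_mass_of_const _ M (eta * L)).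
    * lra.
    * apply (exterior_large n eta L M q); try assumption; lra.
    * intros r Hr; now apply mass_exterior.
  + intros He.
    assert (H1 := Rmin_l 1 (d / A)); assert (H2 := Rmin_r 1 (d / A)).
    split; [| split; [| split]].
    * now apply horizon_free_mass with q.
    * now apply junction_free_shell with q eps.
    * apply junction_free_shell with q eps; try assumption; nra.
    * intros r Hr; apply energy_conditions_shell with q; try assumption; [lra |].
      apply Rle_div_r; [exact A0 | fold d A; lra].
Qed.
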